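(* Let $(a_{ij})_{i,j=1}^r$ be the Cartan matrix of a complex simple Lie group $G$ and $d_i$ coprime positive integers with $d_ia_{ij}=d_ja_{ji}$; let $w=s_{i_1}\cdots s_{i_r}$ be a reduced decomposition of a Coxeter element. Considered as functions on $S'_{w,w}$, the functions $\chi^\pm_i,F_i,G_i$ ($1\le i\le r$) defined in the context have the following Poisson brackets: $$\{\chi^+_i,\chi^+_j\}=\{\chi^-_i,\chi^-_j\}=0,\qquad \{\chi^+_i,\chi^-_j\}=-2d_ia_{ij}\chi^+_i\chi^-_j,$$ $$\{\chi^\pm_i,F_j\}=\{\chi^\pm_i,G_j\}=0,\qquad \{F_i,G_j\}=-2d_i\delta_{ij}F_iG_j .$$
   Context: $S'_{w,w}$ is the Zariski open part of the Coxeter symplectic leaf of the double $D(B)=G\times H$ of a Borel subgroup $B$ of $G$, parametrized by coordinates $A_i,B_i,C_i,D_i\in\mathbb C^\times$, $1\le i\le r$. In these coordinates the Poisson bracket is $$\{A_i,B_j\}=-d_i\delta_{ij}A_iB_j,\qquad \{D_i,C_j\}=d_i\delta_{ij}D_iC_j,$$ and all other brackets among the $A_i,B_i,C_i,D_i$ vanish. (The coordinates correspond to the point $(UL^{-1},\theta(U)\theta^-(L))\in G\times H$ with $U=\prod_{k=1}^r\phi_{i_k}\begin{pmatrix}A_{i_k}&B_{i_k}\\0&A_{i_k}^{-1}\end{pmatrix}$ and $L^{-1}=\prod_{k=1}^r\phi_{i_k}\begin{pmatrix}D_{i_k}&0\\C_{i_k}&D_{i_k}^{-1}\end{pmatrix}^{-1}$,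 products in the order $k=1,\dots,r$, where $\phi_i:SL_2\to G$ is the homomorphism of the $i$-th simple root and $\theta,\theta^-$ are the projections of $B$, $B^-$ to the Cartan subgroup $H$.) A Coxeter element is a product of all simple reflections, each appearing exactly once. For $i=i_\beta$ let $\{i\}_+=\{i_\gamma:\gamma>\beta\}$, $\{i\}_-=\{i_\gamma:\gamma<\beta\}$. Define $$V_i=B_iA_i\prod_{j\in\{i\}_-}A_j^{a_{ji}},\qquad W_i=C_iD_i^{-1}\prod_{j\in\{i\}_+}D_j^{-a_{ji}},$$ $$\chi^+_i=V_iW_i,\qquad \chi^-_i=\chi^+_i\prod_{j=1}^r\Big(\frac{A_j}{D_j}\Big)^{-a_{ji}},$$ $$G_i=\frac{B_i}{C_i}A_iD_i\prod_{j\in\{i\}_+}A_j^{a_{ji}}\prod_{j\in\{i\}_-}D_j^{a_{ji}},\qquad F_i=A_iD_i .$$ *)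

(* Defs.v *)
(* MathComp / MathComp-Analysis *)
From HB Require Import structures.
From mathcomp Require Import all_boot all_order all_algebra.
From mathcomp Require Import complex.
From mathcomp Require Import reals topology normedtype derive.

Set Implicit Arguments.
Unset Strict Implicit.
Unset Printing Implicit Defensive.
Import Order.TTheory GRing.Theory Num.Theory.
Import numFieldNormedType.Exports.
Local Open Scope ring_scope.

Section LieAlgebra.
Variables (K : fieldType) (g : vectType K) (br : g -> g -> g).

Record lie_bracket : Prop := LieBracket {
  lie_linearl : forall c x y z, br (c *: x + y) z = c *: br x z + br y z;
  lie_linearr : forall c x y z, br x (c *: y + z) = c *: br x y + br x z;
  lie_alternating : forall x, br x x = 0;
  lie_jacobi : forall x y z, br x (br y z) + br y (br z x) + br z (br x y) = 0
}.

Definition lie_ideal (I : {vspace g}) : Prop :=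
  forall x y, y \in I -> br x y \in I.

Definition simple_lie_algebra : Prop :=
  [/\ lie_bracket,
      exists x y, br x y != 0
    & forall I : {vspace g}, lie_ideal I -> I = 0%VS \/ I = fullv].

Definition lie_prod (U V : {vspace g}) : {vspace g} :=
  <<[seq br x y | x <- vbasis U, y <- vbasis V]>>%VS.

Definition cartan_subalgebra (H : {vspace g}) : Prop :=
  [/\ forall x y, x \in H -> y \in H -> br x y \in H,
      exists n, iter n (lie_prod H) H = 0%VS
    & forall x, (forall h, h \in H -> br x h \in H) -> x \in H].

Variable H : {vspace g}.

Definition dual : vectType K := 'Hom(subvs_of H, K^o).

(* A Cartan subalgebra of a simple complex Lie algebra acts diagonalizably, so
   eigenvectors, not generalized ones, are used. *)
Definition in_root_space (l : dual) (x : g) : Prop :=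
  forall h : subvs_of H, br (vsval h) x = (l h : K) *: x.

Definition is_root (l : dual) : Prop :=
  l != 0 /\ exists2 x, x != 0 & in_root_space l x.

Definition simple_roots (r : nat) (alpha : 'I_r -> dual) : Prop :=
  [/\ forall i, is_root (alpha i),
      basis_of fullv [seq alpha i | i : 'I_r]
    & forall l, is_root l -> exists n : 'I_r -> nat,
        l = \sum_i alpha i *+ n i \/ l = - \sum_i alpha i *+ n i].

(* [g_l, g_{-l}] is one-dimensional, so its normalized generator is itself a
   bracket of root vectors. *)
Definition is_coroot (l : dual) (t : subvs_of H) : Prop :=
  (exists x y, [/\ in_root_space l x, in_root_space (- l) y & br x y = vsval t])
  /\ (l t : K) = 2.

End LieAlgebra.

Section WeylGroup.
Variables (K : fieldType) (g : vectType K) (H : {vspace g}) (r : nat).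
Variables (alpha : 'I_r -> dual H) (co : 'I_r -> subvs_of H).

Definition simple_reflection (i : 'I_r) (l : dual H) : dual H :=
  l - (l (co i) : K) *: alpha i.

(* s_{i_1} ... s_{i_n} acting on l, the rightmost factor first. *)
Definition word_action (s : seq 'I_r) (l : dual H) : dual H :=
  foldr simple_reflection l s.

Definition coxeter_element (w : dual H -> dual H) : Prop :=
  exists2 s, perm_eq s (enum 'I_r) & w =1 word_action s.

Definition reduced_decomposition (w : dual H -> dual H) (s : seq 'I_r) : Prop :=
  w =1 word_action s /\
  forall s', w =1 word_action s' -> (size s <= size s')%N.

End WeylGroup.

(* A point is the 4 x r matrix with rows (A_i), (B_i), (C_i), (D_i). *)
Definition rowA : 'I_4 := @Ordinal 4 0 isT.
Definition rowB : 'I_4 := @Ordinal 4 1 isT.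
Definition rowC : 'I_4 := @Ordinal 4 2 isT.
Definition rowD : 'I_4 := @Ordinal 4 3 isT.

Section Leaf.
Variables (K : numFieldType) (r : nat).
Implicit Types (f h : 'M[K]_(4, r) -> K) (p : 'M[K]_(4, r)) (i : 'I_r).

(* The coordinates take nonzero values; functions on the leaf are given
   as functions on the ambient affine space, and only their values on this
   open set matter. *)
Definition leaf p : Prop := forall c i, p c i != 0.

Definition cA i p : K := p rowA i.
Definition cB i p : K := p rowB i.
Definition cC i p : K := p rowC i.
Definition cD i p : K := p rowD i.

Definition pderiv (c : 'I_4) i f p : K := 'D_(delta_mx c i) f p.

(* The bivector whose only nonzero coordinate brackets are, up to
   antisymmetry, {A_i, B_i} = - d_i A_i B_i and {D_i, C_i} = d_i D_i C_i. *)
Definition pbracket (d : 'I_r -> nat) f h p : K :=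
  \sum_i
    (- (d i)%:R * cA i p * cB i p *
       (pderiv rowA i f p * pderiv rowB i h p
        - pderiv rowB i f p * pderiv rowA i h p)
     + (d i)%:R * cD i p * cC i p *
       (pderiv rowD i f p * pderiv rowC i h p
        - pderiv rowC i f p * pderiv rowD i h p)).

Variables (a : 'M[int]_r) (s : seq 'I_r).

(* {i}_+ and {i}_- for the word s. *)
Definition letters_after i : {set 'I_r} := [set j in drop (index i s).+1 s].
Definition letters_before i : {set 'I_r} := [set j in take (index i s) s].

Definition funV i p : K :=
  cB i p * cA i p * \prod_(j in letters_before i) cA j p ^ a j i.

Definition funW i p : K :=
  cC i p * (cD i p)^-1 * \prod_(j in letters_after i) cD j p ^ (- a j i).

Definition chi_plus i p : K := funV i p * funW i p.

Definition chi_minus i p : K :=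
  chi_plus i p * \prod_j (cA j p / cD j p) ^ (- a j i).

Definition funG i p : K :=
  cB i p / cC i p * cA i p * cD i p
  * \prod_(j in letters_after i) cA j p ^ a j i
  * \prod_(j in letters_before i) cD j p ^ a j i.

Definition funF i p : K := cA i p * cD i p.

End Leaf.

(* Main.v *)
(** Every function involved is a Laurent monomial in the coordinates, and dilating
    one coordinate by t multiplies a Laurent monomial by a power of t; so its
    logarithmic derivatives are its exponents, and the bracket of two of them is
    their product times an integer bilinear in the exponents. The symmetry of
    (d_i a_ij) then gives all the brackets, once each letter is known to occur
    exactly once in the word. That follows from the action on the roots: a word
    moves a weight only along the simple roots of its letters, whereas a Coxeter
    element moves some weight along any given simple root. *)
Require Import Defs.
From HB Require Import structures.
From mathcomp Require Import all_boot all_order all_algebra.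
From mathcomp Require Import ring zify.
From mathcomp Require Import complex.
From mathcomp Require Import boolp classical_sets functions.
From mathcomp Require Import reals topology normedtype derive.

Set Implicit Arguments.
Unset Strict Implicit.
Unset Printing Implicit Defensive.
Import Order.TTheory GRing.Theory Num.Theory.
Import numFieldNormedType.Exports.
Local Open Scope ring_scope.
Local Open Scope classical_set_scope.
Local Open Scope complex_scope.

(** * Words in the simple reflections and the letters they must contain *)

Section CoxeterWords.
Variables (K : numFieldType) (g : vectType K) (H : {vspace g}) (r : nat).
Variables (alpha : 'I_r -> dual H) (co : 'I_r -> subvs_of H).
Hypothesis alpha_co : forall i, (alpha i (co i) : K) = 2.
Hypothesis alpha_free : forall k : 'I_r -> K,
  \sum_j k j *: alpha j = 0 -> forall j, k j = 0.

Lemma word_action_cat s1 s2 l :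
  word_action alpha co (s1 ++ s2) l
  = word_action alpha co s1 (word_action alpha co s2 l).
Proof. exact: foldr_cat. Qed.

(** Each reflection subtracts a multiple of its own simple root, so by induction only the
    coefficient of the head letter changes at each stage. *)
Lemma word_action_letters s l : exists2 k : 'I_r -> K,
  word_action alpha co s l = l - \sum_j k j *: alpha j
  & forall j, j \notin s -> k j = 0.
Proof.
elim: s => [|x s [k kE k0]].
  by exists (fun=> 0) => //; rewrite big1 ?subr0 // => j _; rewrite scale0r.
set m := word_action alpha co s l in kE.
exists (fun j => k j + (j == x)%:R * (m (co x) : K)).
  rewrite /= -/m /simple_reflection {1}kE -addrA -opprD; congr (_ - _).
  under [RHS]eq_bigr do rewrite scalerDl.
  rewrite big_split /=; congr (_ + _).
  rewrite (bigD1 x) //= eqxx mul1r big1 ?addr0 // => j /negbTE ->.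
  by rewrite mul0r scale0r.
move=> j; rewrite inE negb_or => /andP[/negbTE -> /k0 ->].
by rewrite mul0r addr0.
Qed.

Lemma simple_reflection_alpha i : simple_reflection alpha co i (alpha i) = - alpha i.
Proof. by rewrite /simple_reflection alpha_co scaler_nat mulr2n opprD addNKr. Qed.

Lemma simple_reflectionK i : involutive (simple_reflection alpha co i).
Proof.
move=> l; rewrite /simple_reflection !lfunE /= !lfunE /= !lfunE /= alpha_co.
rewrite -addrA -opprD -scalerDl.
suff -> : l (co i) + (l (co i) - l (co i) *: (2 : K^o)) = 0 :> K.
  by rewrite scale0r subr0.
by rewrite /GRing.scale /=; ring.
Qed.

Lemma word_action_revK s l :
  word_action alpha co s (word_action alpha co (rev s) l) = l.
Proof.
elim: s => //= x s IH in l *.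
by rewrite rev_cons -cats1 word_action_cat IH /= simple_reflectionK.
Qed.

(** Split [s] as [s1], [i], [s2] and test both words on the weight [rev s2] applied to [alpha i]. As
    [i] occurs in neither [s1] nor [s2], this weight has coefficient 1 along [alpha i], and [s]
    turns it into -1. A word without [i] would leave it equal to 1. *)
Lemma mem_coxeter_word s t i :
    perm_eq s (enum 'I_r) ->
    word_action alpha co s =1 word_action alpha co t ->
  i \in t.
Proof.
move=> s_perm st; apply/negPn/negP => i_t.
have s_uniq : uniq s by rewrite (perm_uniq s_perm) enum_uniq.
have i_s : i \in s by rewrite (perm_mem s_perm) mem_enum.
move: s_uniq st s_perm; case/path.splitPr: s / i_s => s1 s2 s_uniq st s_perm.
move: s_uniq; rewrite cat_uniq /= negb_or => /and4P[_ /andP[i_s1 _] i_s2 _].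
have /esym := st (word_action alpha co (rev s2) (alpha i)).
rewrite word_action_cat /= word_action_revK simple_reflection_alpha.
have [k1 -> k10] := word_action_letters s1 (- alpha i).
have [k3 -> k30] := word_action_letters t (word_action alpha co (rev s2) (alpha i)).
have [k2 -> k20] := word_action_letters (rev s2) (alpha i).
(* These are the coefficients of the image under [t] minus the image under [s]. At [i] all of [k1],
   [k2], [k3] vanish, so independence of the simple roots would force 2 = 0. *)
set k := fun j => 2 * (j == i)%:R + k1 j - k2 j - k3 j.
move=> /eqP; rewrite -subr_eq0 => /eqP kE.
have /alpha_free/(_ i) : \sum_j k j *: alpha j = 0.
  rewrite -[RHS]kE /k.
  under eq_bigr do rewrite !scalerBl scalerDl.
  rewrite !sumrB big_split /= (bigD1 i) //= eqxx mulr1 big1 ?addr0; last first.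
    by move=> j /negbTE ->; rewrite mulr0 scale0r.
  rewrite scaler_nat mulr2n opprD !opprK -(addrA (alpha i)) (addrC (alpha i)).
  by rewrite [RHS]addrC -!addrA.
rewrite /k eqxx mulr1 k10 // k30 // k20 ?mem_rev // addr0 !subr0.
by move/eqP; rewrite pnatr_eq0.
Qed.

(** A word of length [r] in which all [r] letters occur has no room for a repetition. *)
Lemma coxeter_word_letters s (t : r.-tuple 'I_r) :
    perm_eq s (enum 'I_r) ->
    word_action alpha co s =1 word_action alpha co t ->
  uniq t /\ forall i, i \in t.
Proof.
move=> s_perm st; have t_all i : i \in t by apply: mem_coxeter_word st.
split=> //.
rewrite (@leq_size_uniq _ (enum 'I_r) t) ?enum_uniq //.
by rewrite size_tuple size_enum_ord.
Qed.

End CoxeterWords.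

Lemma basis_of_sum_eq0 (K : fieldType) (V : vectType K) (U : {vspace V})
    (r : nat) (v : 'I_r -> V) :
    basis_of U [seq v i | i : 'I_r] ->
  forall k : 'I_r -> K, \sum_j k j *: v j = 0 -> forall j, k j = 0.
Proof.
move=> /basis_free v_free k k0.
have /(freeP (X := map_tuple v (ord_tuple r))) : free (map_tuple v (ord_tuple r)).
  exact: v_free.
apply; rewrite -[RHS]k0; apply: eq_bigr => j _.
by rewrite -tnth_nth tnth_map tnth_ord_tuple.
Qed.

(** * Laurent monomials, their derivatives and their brackets *)

Section LaurentMonomials.
Variables (K : numFieldType) (r : nat).
Implicit Types (f h : 'M[K]_(4, r) -> K) (p : 'M[K]_(4, r)) (E : 'I_4 -> 'I_r -> int).

Definition dilate (c : 'I_4) (k : 'I_r) (t : K) p : 'M[K]_(4, r) :=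
  \matrix_(c', k') (t ^+ ((c' == c) && (k' == k)) * p c' k').

(** A monomial is described by its weights under dilations rather than by a formula, which makes
    products, powers and inverses immediate. Points with zero entries are harmless, since the
    inverse of 0 is 0. *)
Definition laurent f E : Prop :=
  forall c k t p, t != 0 -> f (dilate c k t p) = t ^ E c k * f p.

Lemma laurent_coord c k :
  laurent (fun p => p c k) (fun c' k' => ((c' == c) && (k' == k))%:Z).
Proof. by move=> c' k' t p _; rewrite mxE (eq_sym c) (eq_sym k). Qed.

Lemma laurent_mul f h E E' : laurent f E -> laurent h E' ->
  laurent (fun p => f p * h p) (fun c k => E c k + E' c k).
Proof. by move=> fE hE c k t p t0; rewrite fE // hE // expfzDr // mulrACA. Qed.

Lemma laurent_exprz f E (n : int) : laurent f E ->
  laurent (fun p => f p ^ n) (fun c k => E c k * n).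
Proof. by move=> fE c k t p t0; rewrite fE // expfzMl exprz_exp. Qed.

Lemma laurent_inv f E : laurent f E ->
  laurent (fun p => (f p)^-1) (fun c k => - E c k).
Proof. by move=> fE c k t p t0; rewrite fE // invfM invr_expz. Qed.

Lemma laurent_prod (I : finType) (P : pred I) (f : I -> _) (E : I -> _) :
    (forall i, laurent (f i) (E i)) ->
  laurent (fun p => \prod_(i | P i) f i p) (fun c k => \sum_(i | P i) E i c k).
Proof.
move=> fE c k t p t0.
rewrite (big_morph (fun x : int => t ^ x) (fun x y => expfzDr x y t0) (expr0z t)).
by rewrite -big_split /=; apply: eq_bigr => i _; rewrite fE.
Qed.

Lemma laurent_ext f E E' : (forall c k, E c k = E' c k) -> laurent f E -> laurent f E'.
Proof. by move=> EE' fE c k t p t0; rewrite fE // EE'. Qed.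

(** The normalization [u x = 1] removes the factor [u x ^ (n - 1)], so one formula covers exponents
    of both signs. It suffices for a dilation factor, which is 1 at the base point. *)
Lemma is_derive_exprz1 (V : normedModType K) (u : V -> K) (x v : V) (du : K) (n : int) :
  u x = 1 -> is_derive x v u du -> is_derive x v (fun y => u y ^ n) (n%:~R * du).
Proof.
move=> ux uD.
have pos m : is_derive x v (fun y => u y ^+ m) (m%:R * du).
  have -> : (fun y => u y ^+ m) = u ^+ m by apply/funext => y; rewrite fctE.
  by apply: is_derive_eq; rewrite ux expr1n mulr1.
case: n => m; first exact: pos.
have [mD mE] := pos m.+1.
have m1 : u x ^+ m.+1 = 1 by rewrite ux expr1n.
have m0 : u x ^+ m.+1 != 0 by rewrite m1 oner_neq0.
split; first exact: derivableV.
by rewrite deriveV // mE m1 expr1n invr1 NegzE mulrNz mulNr scaleN1r.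
Qed.

(** Adding [z] to the coordinate [p c k] amounts to dilating it by [u z = 1 + z / p c k]. Along this
    line [f] is therefore [f p] times a power of [u], to be differentiated at 0. *)
Lemma pderiv_laurent f E p c k : laurent f E -> p c k != 0 ->
  pderiv c k f p = (E c k)%:~R / p c k * f p.
Proof.
move=> fE x0.
pose u (z : K) := 1 + z * (p c k)^-1.
have u1 : u 0 = 1 by rewrite /u mul0r addr0.
have uD : is_derive (0 : K) (1 : K) u (p c k)^-1.
  have -> : u = cst 1 + (p c k)^-1 \*: (@idfun K).
    by apply/funext => z; rewrite /u fctE /= /GRing.scale /= mulrC.
  by apply: is_derive_eq; rewrite add0r /GRing.scale /= mulr1.
(* The hypothesis on [f] concerns nonzero dilation factors, so the formula along the line is
   available only near 0, which determines the derivative. *)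
have u_near : \forall z \near (0 : K), u z != 0.
  have : {for 0, continuous u}.
    exact/differentiable_continuous/derivable1_diffP.
  move=> /cvgr_neq0; apply; by rewrite u1 oner_neq0.
have line z : z *: delta_mx c k + p = dilate c k (u z) p.
  apply/matrixP => c' k'; rewrite !mxE; case: andP => [[/eqP-> /eqP->]|_] /=.
    by rewrite mulr1 mulrDl mul1r divfK // addrC.
  by rewrite mulr0 add0r mul1r.
pose F (z : K) := f (z *: delta_mx c k + p).
have -> : pderiv c k f p = 'D_1 F 0.
  rewrite /pderiv /derive.
  set q := (fun z : K => _); set q' := (fun z : K => _ *: (_ - F 0)).
  suff -> : q = q' by [].
  apply/funext => z; rewrite /q /q' /F /=.
  by rewrite addr0 [z *: 1]mulr1 scale0r add0r.
have FE : \forall z \near (0 : K), F z = f p * u z ^ E c k.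
  by near=> z; rewrite /F line fE 1?mulrC //; near: z.
have uED := is_derive_exprz1 (E c k) u1 uD.
rewrite (near_eq_derive _ FE).
have -> : (fun z => f p * u z ^ E c k) = f p \*: (fun z => u z ^ E c k).
  by apply/funext.
by rewrite deriveZ // derive_val /GRing.scale /= mulrC.
Unshelve. all: by end_near. Qed.

(* The rows are those of A, B, C, D; each monomial here involves B_k and C_k for
   a single k = i. *)
Definition expo (i : 'I_r) (b e : int) (x y : 'I_r -> int) (c : 'I_4) (k : 'I_r) : int :=
  match val c with
  | 0 => x k
  | 1 => b * (k == i)%:Z
  | 2 => e * (k == i)%:Z
  | _ => y k
  end.

(** The quadratic coefficients of the bivector cancel the denominators of the logarithmic
    derivatives. As [f] involves rows B and C only at [i], and [h] only at [j], the sum over [k]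
    collapses to these two indices. *)
Lemma pbracket_laurent (d : 'I_r -> nat) f h i j b e x y b' e' x' y' p :
    laurent f (expo i b e x y) -> laurent h (expo j b' e' x' y') -> leaf p ->
  pbracket d f h p =
    ((d i)%:Z * (b * x' i - e * y' i) - (d j)%:Z * (b' * x j - e' * y j))%:~R
    * f p * h p.
Proof.
move=> fE hE p0.
pose T k : int := (k == i)%:Z * ((d k)%:Z * (b * x' k - e * y' k))
  - (k == j)%:Z * ((d k)%:Z * (b' * x k - e' * y k)).
transitivity ((\sum_k T k)%:~R * f p * h p); last first.
  rewrite sumrB (bigD1 i) //= eqxx mul1r big1 => [|k /negbTE ->]; last exact: mul0r.
  rewrite addr0 (bigD1 j) //= eqxx mul1r big1 => [|k /negbTE ->]; last exact: mul0r.
  by rewrite addr0.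
rewrite rmorph_sum /= !mulr_suml; apply: eq_bigr => k _.
rewrite !(pderiv_laurent fE) ?(pderiv_laurent hE) // /expo /= /cA /cB /cC /cD /T.
rewrite !(rmorphB, rmorphM) /=.
by field; rewrite !p0.
Qed.

(** * Exponents of [chi_plus], [chi_minus], [funG] and [funF] *)

Variables (a : 'M[int]_r) (s : seq 'I_r).

(** This evaluates the exponent of a product of powers taken from a single row; [u] is the test that
    the dilated coordinate lies in that row. *)
Lemma sum_delta (u : bool) (P : pred 'I_r) (n : 'I_r -> int) k :
  \sum_(j | P j) (u && (k == j))%:Z * n j = (u && P k)%:Z * n k.
Proof.
rewrite big_mkcond (bigD1 k) //= eqxx andbT big1 ?addr0.
  by case: (P k); rewrite ?andbT ?andbF ?mul0r.
move=> j /negbTE; rewrite eq_sym => ->.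
by rewrite andbF mul0r; case: ifP.
Qed.

Lemma laurent_chi_plus i : laurent (chi_plus a s i)
  (expo i 1 1 (fun k => (k == i)%:Z + (k \in letters_before s i)%:Z * a k i)
              (fun k => - ((k == i)%:Z + (k \in letters_after s i)%:Z * a k i))).
Proof.
apply: laurent_ext (laurent_mul
  (laurent_mul
    (laurent_mul (laurent_coord rowB i) (laurent_coord rowA i))
    (laurent_prod (mem (letters_before s i))
      (fun j => laurent_exprz (a j i) (laurent_coord rowA j))))
  (laurent_mul
    (laurent_mul (laurent_coord rowC i) (laurent_inv (laurent_coord rowD i)))
    (laurent_prod (mem (letters_after s i))
      (fun j => laurent_exprz (- a j i) (laurent_coord rowD j))))) => c k.
rewrite !sum_delta.
by case: c => [[|[|[|[|//]]]] c4]; rewrite -!val_eqE /expo /=; ring.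
Qed.

Lemma laurent_chi_minus i : laurent (chi_minus a s i)
  (expo i 1 1 (fun k => (k == i)%:Z + (k \in letters_before s i)%:Z * a k i - a k i)
              (fun k => a k i - ((k == i)%:Z + (k \in letters_after s i)%:Z * a k i))).
Proof.
apply: laurent_ext (laurent_mul (laurent_chi_plus i)
  (laurent_prod predT (fun j => laurent_exprz (- a j i)
    (laurent_mul (laurent_coord rowA j) (laurent_inv (laurent_coord rowD j)))))) => c k.
under eq_bigr do rewrite mulrDl mulNr.
rewrite big_split sumrN /= !sum_delta.
by case: c => [[|[|[|[|//]]]] c4]; rewrite -!val_eqE /expo /=; ring.
Qed.

Lemma laurent_funG i : laurent (funG a s i)
  (expo i 1 (-1) (fun k => (k == i)%:Z + (k \in letters_after s i)%:Z * a k i)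
                 (fun k => (k == i)%:Z + (k \in letters_before s i)%:Z * a k i)).
Proof.
apply: laurent_ext (laurent_mul
  (laurent_mul
    (laurent_mul
      (laurent_mul
        (laurent_mul (laurent_coord rowB i) (laurent_inv (laurent_coord rowC i)))
        (laurent_coord rowA i))
      (laurent_coord rowD i))
    (laurent_prod (mem (letters_after s i))
      (fun j => laurent_exprz (a j i) (laurent_coord rowA j))))
  (laurent_prod (mem (letters_before s i))
    (fun j => laurent_exprz (a j i) (laurent_coord rowD j)))) => c k.
rewrite !sum_delta.
by case: c => [[|[|[|[|//]]]] c4]; rewrite -!val_eqE /expo /=; ring.
Qed.

Lemma laurent_funF i : laurent (funF (r := r) i)
  (expo i 0 0 (fun k => (k == i)%:Z) (fun k => (k == i)%:Z)).
Proof.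
apply: laurent_ext (laurent_mul (laurent_coord rowA i) (laurent_coord rowD i)) => c k.
by case: c => [[|[|[|[|//]]]] c4]; rewrite -!val_eqE /expo /=; ring.
Qed.

End LaurentMonomials.

(** * Positions of letters in a word *)

Lemma mem_letters_before r (s : seq 'I_r) i j :
  j \in s -> (j \in letters_before s i) = (index j s < index i s)%N.
Proof. by move=> js; rewrite inE in_take. Qed.

(** Without repetitions, the letters after [i] are exactly those missing from the prefix that ends
    with [i] itself, whence the successor in its length. *)
Lemma mem_letters_after r (s : seq 'I_r) i j :
  uniq s -> j \in s -> (j \in letters_after s i) = (index i s < index j s)%N.
Proof.
move=> s_uniq js; rewrite inE ltnNge -ltnS -in_take //.
have := s_uniq; rewrite -{1}(cat_take_drop (index i s).+1 s) cat_uniq => /and3P[_ /hasPn disj _].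
move: js; rewrite -{1}(cat_take_drop (index i s).+1 s) mem_cat.
have [/disj /negbTE /= -> //|_] := boolP (j \in drop _ _).
by rewrite orbF => ->.
Qed.

Theorem proposition7 (R : realType)
  (g : vectType R[i]) (br : g -> g -> g) (H : {vspace g})
  (r : nat) (alpha : 'I_r -> dual H) (co : 'I_r -> subvs_of H)
  (a : 'M[int]_r) (d : 'I_r -> nat)
  (w : dual H -> dual H) (word : r.-tuple 'I_r)
  (g_simple : simple_lie_algebra br)
  (H_cartan : cartan_subalgebra br H)
  (alpha_simple : simple_roots br alpha)
  (co_coroot : forall i, is_coroot br (alpha i) (co i))
  (a_cartan : forall i j, ((a i j)%:~R : R[i]) = alpha j (co i))
  (d_pos : forall i, (0 < d i)%N)
  (d_coprime : \big[gcdn/0%N]_(i < r) d i = 1%N)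
  (d_sym : forall i j, (d i)%:Z * a i j = (d j)%:Z * a j i)
  (w_coxeter : coxeter_element alpha co w)
  (w_reduced : reduced_decomposition alpha co w word)
  (i j : 'I_r) (p : 'M[R[i]]_(4, r)) (p_leaf : leaf p) :
  [/\ pbracket d (chi_plus a word i) (chi_plus a word j) p = 0 /\
      pbracket d (chi_minus a word i) (chi_minus a word j) p = 0,
      pbracket d (chi_plus a word i) (chi_minus a word j) p
        = - 2 * (d i)%:R * (a i j)%:~R
          * chi_plus a word i p * chi_minus a word j p,
      pbracket d (chi_plus a word i) (funF j) p = 0 /\
      pbracket d (chi_minus a word i) (funF j) p = 0,
      pbracket d (chi_plus a word i) (funG a word j) p = 0 /\
      pbracket d (chi_minus a word i) (funG a word j) p = 0
    & pbracket d (funF i) (funG a word j) p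
        = - 2 * (d i)%:R * (i == j)%:R * funF i p * funG a word j p].
Proof.
have alpha_co k : (alpha k (co k) : R[i]) = 2 by have [] := co_coroot k.
have [_ alpha_basis _] := alpha_simple.
have [s s_perm ws] := w_coxeter.
have [wt _] := w_reduced.
have st : word_action alpha co s =1 word_action alpha co word.
  by move=> l; rewrite -ws wt.
have [word_uniq word_all] :=
  coxeter_word_letters alpha_co (basis_of_sum_eq0 alpha_basis) s_perm st.
have beforeE k l := mem_letters_before k (word_all l).
have afterE k l := mem_letters_after k word_uniq (word_all l).
have chip := @laurent_chi_plus R[i] r a word.
have chim := @laurent_chi_minus R[i] r a word.
have G := @laurent_funG R[i] r a word.
have F := @laurent_funF R[i] r.
have dij := d_sym i j.
(* Of two distinct letters one strictly precedes the other, which leaves two cases for the order of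
   [i] and [j]. *)
have index_neq : i != j -> index i word != index j word.
  by apply: contra => /eqP ij; rewrite -(nth_index i (word_all i)) ij nth_index.
rewrite (pbracket_laurent d (chip i) (chip j) p_leaf).
rewrite (pbracket_laurent d (chim i) (chim j) p_leaf).
rewrite (pbracket_laurent d (chip i) (chim j) p_leaf).
rewrite (pbracket_laurent d (chip i) (F j) p_leaf).
rewrite (pbracket_laurent d (chim i) (F j) p_leaf).
rewrite (pbracket_laurent d (chip i) (G j) p_leaf).
rewrite (pbracket_laurent d (chim i) (G j) p_leaf).
rewrite (pbracket_laurent d (F i) (G j) p_leaf).
(* Each bracket is thereby reduced to an identity between integers, linear in the products of [d]
   and [a], with [dij] as the one relation among them. *)
have E (n m : int) (x y z : R[i]) : n = m -> m%:~R = z -> n%:~R * x * y = z * x * y.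
  by move=> -> ->.
have E0 (n : int) (x y : R[i]) : n = 0 -> n%:~R * x * y = 0.
  by move=> ->; rewrite !mul0r.
rewrite !beforeE !afterE (eq_sym j i).
have [ij|ij] := eqVneq i j.
  subst j; rewrite ltnn; split.
  1,3,4: by split; apply: E0; lia.
    by apply: (E _ (- 2 * (d i)%:Z * a i i)); [lia|rewrite !rmorphM].
  by apply: (E _ (- 2 * (d i)%:Z)); [lia|rewrite rmorphM /= mulr1].
(* In either order, the A exponent minus the D exponent at [i] is [a i j] for [chi_plus j] and
   [- a i j] for [chi_minus j]. The brackets among these thus reduce to sums or differences of
   [d i * a i j] and [d j * a j i]. Against [funG j], the A and D exponents of [chi_plus i] or
   [chi_minus i] at [j] add up to [a j i] with a sign given by the order, and this cancels the
   contribution of [funG j] at [i]. *)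
have /index_neq := ij; case: ltngtP => // _ _; split.
1,3,4,6,8,9: by split; apply: E0; lia.
1,3: by apply: (E _ (- 2 * (d i)%:Z * a i j)); [lia|rewrite !rmorphM].
all: by apply: (E _ 0); [lia|rewrite mulr0].
Qed.
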